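(* Let $G_s=(V,E,P_s)$ be a signed graph with $V=\{1,\dots,n\}$, and consider LTI networks $\dot x = Ax+Bu$ with $A\in\mathcal{Q}_s(G_s)$ and $B=[e_{j_1},\ldots,e_{j_m}]$, where $V_C=\{j_1,\ldots,j_m\}\subseteq V$ is the set of control nodes. Then: (i) if $V_C$ is a positive signed zero forcing set of $G_s$, then for every $A\in\mathcal{Q}_s(G_s)$, every positive eigenvalue of $A$ is a controllable eigenvalue of $(A,B)$; (ii) if $V_C$ is a negative signed zero forcing set of $G_s$, then for every $A\in\mathcal{Q}_s(G_s)$, every negative eigenvalue of $A$ is a controllable eigenvalue of $(A,B)$; (iii) if $V_C$ is a signed zero forcing set of $G_s$, then for every $A\in\mathcal{Q}_s(G_s)$ having $0$ as an eigenvalue, the eigenvalue $0$ is a controllable eigenvalue of $(A,B)$.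
   Context: **Sign patterns and signed graphs.** $\mathrm{sign}:\mathbb{R}\to\{+,-,0\}$ is the sign function, and $\mathrm{inv}(+)=-$, $\mathrm{inv}(-)=+$. A sign pattern $P_s$ is an $n\times n$ matrix whose off-diagonal entries lie in $\{+,-,0\}$ and whose diagonal entries lie in $\{+,-,0,?\}$. A real matrix $A\in\mathbb{R}^{n\times n}$ has sign pattern $P_s$ if $(P_s)_{ij}=\mathrm{sign}(A_{ij})$ for all $i\ne j$ and $(P_s)_{ii}=\mathrm{sign}(A_{ii})$ whenever $(P_s)_{ii}\neq ?$; if $(P_s)_{ii}=?$, $A_{ii}$ is an arbitrary real number. A signed graph $G_s=(V,E,P_s)$ has $V=\{1,\dots,n\}$ and $(i,j)\in E$ (an edge from $i$ to $j$) iff $(P_s)_{ji}\neq 0$; the edge $(i,j)$ carries the label $(P_s)_{ji}$. Self-loops are allowed and may carry the label $+$, $-$ or $?$. $N_{out}(v)=\{u:(v,u)\in E\}$ (it contains $v$ if $v$ has a self-loop). The qualitative class $\mathcal{Q}_s(G_s)$ is the set of all real $n\times n$ matrices with sign pattern $P_s$; if $G_s$ is considered as an undirected signed graph ($P_s$ symmetric), $\mathcal{Q}_s(G_s)$ is the set of all symmetric real matrices with sign pattern $P_s$. **Looped graphs.** $P_s^{+}$ (resp. $P_s^{-}$) is obtained from $P_s$ by adding $+$ (resp. $-$) to every diagonal entry using the rules $?+s=?$, $0+s=s$, $r+r=r$, $r+\mathrm{inv}(r)=?$ for $r\in\{+,-\}$. The positive looped graph is $G_s^+=(V,E,P_s^+)$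 and the negative looped graph is $G_s^-=(V,E,P_s^-)$, where the edge sets are those determined by $P_s^+$, $P_s^-$ (so every node has a self-loop). **Signing and coloring game** on a signed graph with pattern $P_s$. Each node is black or white; each white node $u$ is either marked, with $m(u)\in\{+,-\}$, or unmarked, $m(u)=*$. A node turned black has sign zero and is no longer counted as marked. Initially the nodes of a given set $Z\subseteq V$ are black, all others are white and unmarked. For $v\in V$ let $W(v)$ be the set of white out-neighbors of $v$, $W_+(v)=\{u\in W(v): m(u)=(P_s)_{uv}\}$, $W_-(v)=\{u\in W(v): m(u)=\mathrm{inv}((P_s)_{uv})\}$, $W_*(v)=\{u\in W(v): m(u)=*\}$. Let $v$ be a node that is either black, or white with $(P_s)_{vv}\neq ?$. The allowed moves are: 1. If $W(v)=\{u\}$, then $u$ becomes black (possibly $u=v$). 2. If $W_+(v)=W(v)$ or $W_-(v)=W(v)$, then all nodes of $W(v)$ become black. 3. If for some $s\in\{+,-\}$, $W_s(v)\ne\emptyset$, $W_{\mathrm{inv}(s)}(v)=\emptyset$ and $W_*(v)=\{w\}$, then $w$ is marked with the product of signs $(P_s)_{wv}\cdot\mathrm{inv}(s)$. 4. If no white node of the graph is marked and $u\in V$ is white, then $u$ may be marked with $+$. The moves are applied as many times as possible. The set $Z$ is a *signed zero forcing set* of $G_s$ if all nodes become black when the game is played on $G_s$ (for some sequence of moves). It is a *positive signed zero forcing set* of $G_s$ if all nodes become black when the game is played on the negative looped graph $G_s^-$ (with pattern $P_s^-$ in place of $P_s$), and a *negative signed zero forcing set* of $G_s$ if all nodes become black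 when the game is played on the positive looped graph $G_s^+$ (with pattern $P_s^+$). **Controllability of eigenvalues.** $e_j$ is the $j$th column of $I_n$. If $(A,B)$ is controllable, all eigenvalues of $A$ are controllable. Otherwise there is a nonsingular $T$ with $T^{-1}AT=\begin{bmatrix}\hat A_{11}&\hat A_{12}\\0&\hat A_{22}\end{bmatrix}$, $T^{-1}B=\begin{bmatrix}\hat B_1\\0\end{bmatrix}$, $(\hat A_{11},\hat B_1)$ controllable, and an eigenvalue $\lambda$ of $A$ is a controllable eigenvalue if it is not an eigenvalue of $\hat A_{22}$. Equivalently (Popov–Belevitch–Hautus test), $w^TB\ne 0$ for every nonzero $w$ with $w^TA=\lambda w^T$. *)

(* Defs.v *)
From HB Require Import structures.
From mathcomp Require Import all_boot all_order all_algebra.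
From mathcomp Require Import reals.
From Stdlib Require Import Relation_Operators.

Set Implicit Arguments.
Unset Strict Implicit.
Unset Printing Implicit Defensive.

Import Order.TTheory GRing.Theory Num.Theory.
Local Open Scope ring_scope.

Variant pm := Plus | Minus.

Definition bool_of_pm (s : pm) : bool := if s is Plus then true else false.
Definition pm_of_bool (b : bool) : pm := if b then Plus else Minus.
Lemma bool_of_pmK : cancel bool_of_pm pm_of_bool.
Proof. by case. Qed.
HB.instance Definition _ := Equality.copy pm (can_type bool_of_pmK).

Definition inv_pm (s : pm) : pm := if s is Plus then Minus else Plus.
Definition mul_pm (s t : pm) : pm := if s is Plus then t else inv_pm t.

(* The entries +, -, 0 and ? of a sign pattern; [Any] stands for ?. *)
Variant label := Sgn of pm | Zero | Any.

Definition sign (R : realType) (x : R) : label :=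
  if 0 < x then Sgn Plus else if x < 0 then Sgn Minus else Zero.

(* The edge (i, j), from i to j, is present iff [sg_pattern j i <> Zero] and is
   then labelled [sg_pattern j i].  [sg_undirected] records that the graph is
   considered as an undirected one, which requires a symmetric pattern and
   restricts the qualitative class to symmetric matrices. *)
Record signed_graph (n : nat) := SignedGraph {
  sg_pattern : 'M[label]_n;
  sg_undirected : bool;
  sg_offdiag : forall i j : 'I_n, i != j -> sg_pattern i j <> Any;
  sg_sym : sg_undirected -> sg_pattern^T = sg_pattern
}.

Definition has_pattern (R : realType) (n : nat) (P : 'M[label]_n)
    (A : 'M[R]_n) : Prop :=
  (forall i j, i != j -> P i j = sign (A i j)) /\
  (forall i, P i i <> Any -> P i i = sign (A i i)).

Definition qual_class (R : realType) (n : nat) (G : signed_graph n)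
    (A : 'M[R]_n) : Prop :=
  has_pattern (sg_pattern G) A /\ (sg_undirected G -> A^T = A).

Definition add_sign (l : label) (s : pm) : label :=
  match l with
  | Any => Any
  | Zero => Sgn s
  | Sgn r => if r == s then Sgn r else Any
  end.

(* [looped Plus P] is P^+ and [looped Minus P] is P^-. *)
Definition looped (n : nat) (s : pm) (P : 'M[label]_n) : 'M[label]_n :=
  \matrix_(i, j) (if i == j then add_sign (P i i) s else P i j).

(* [White None] is a white unmarked node, [White (Some s)] a white node marked
   with s; a black node carries no mark. *)
Variant status := Black | White of option pm.

Section Game.
Variables (n : nat) (P : 'M[label]_n).
Implicit Types (st : {ffun 'I_n -> status}) (u v w : 'I_n) (s t : pm).

Definition white st u : bool := if st u is White _ then true else false.
Definition marked st u : bool := if st u is White (Some _) then true else false.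
Definition edge v u : bool := if P u v is Zero then false else true.

Definition W st v : {set 'I_n} := [set u | edge v u && white st u].

(* [W_sgn st Plus v] is W_+(v) : the mark is the label of the edge (v, u);
   [W_sgn st Minus v] is W_-(v) : the mark is the inverse of that label. *)
Definition W_sgn st s v : {set 'I_n} :=
  [set u in W st v |
    match st u, P u v with
    | White (Some m), Sgn l => m == mul_pm s l
    | _, _ => false
    end].

Definition W_unm st v : {set 'I_n} := [set u in W st v | ~~ marked st u].

Definition active st v : Prop := st v = Black \/ P v v <> Any.

Definition blacken st (S : {set 'I_n}) : {ffun 'I_n -> status} :=
  [ffun x => if x \in S then Black else st x].

Definition set_mark st u s : {ffun 'I_n -> status} :=
  [ffun x => if x == u then White (Some s) else st x].

Inductive move st : {ffun 'I_n -> status} -> Prop :=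
| move_force v u :
    active st v -> W st v = [set u] -> move st (blacken st [set u])
| move_balance v s :
    active st v -> W_sgn st s v = W st v -> move st (blacken st (W st v))
| move_sign v w s l :
    active st v ->
    W_sgn st s v != set0 -> W_sgn st (inv_pm s) v = set0 ->
    W_unm st v = [set w] -> P w v = Sgn l ->
    move st (set_mark st w (mul_pm l (inv_pm s)))
| move_start u :
    (forall x, ~~ marked st x) -> white st u ->
    move st (set_mark st u Plus).

Definition init (Z : {set 'I_n}) : {ffun 'I_n -> status} :=
  [ffun x => if x \in Z then Black else White None].

Definition forces_all (Z : {set 'I_n}) : Prop :=
  exists st, clos_refl_trans _ move (init Z) st /\ forall u, st u = Black.

End Game.

Definition signed_zfs (n : nat) (G : signed_graph n) (Z : {set 'I_n}) : Prop :=
  forces_all (sg_pattern G) Z.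

(* Note the opposite signs: forcing for positive eigenvalues is played on the
   negative looped graph, whose pattern is that of A - lambda I for
   lambda > 0. *)
Definition positive_signed_zfs (n : nat) (G : signed_graph n)
    (Z : {set 'I_n}) : Prop :=
  forces_all (looped Minus (sg_pattern G)) Z.

Definition negative_signed_zfs (n : nat) (G : signed_graph n)
    (Z : {set 'I_n}) : Prop :=
  forces_all (looped Plus (sg_pattern G)) Z.

(* Kalman's rank condition on [B, A B, ..., A^(n-1) B]. *)
Definition controllable (R : realType) (n m : nat) (A : 'M[R]_n)
    (B : 'M[R]_(n, m)) : Prop :=
  \rank (\mxrow_(k < n) (A ^+ k *m B)) = n.

(* T^-1 A T = [A11 A12; 0 A22] and T^-1 B = [B1; 0] with (A11, B1)
   controllable; A11 may be the empty matrix (when B = 0). *)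
Definition kalman_form (R : realType) (n m r q : nat) (e : (r + q)%N = n)
    (A : 'M[R]_n) (B : 'M[R]_(n, m)) (T : 'M[R]_n)
    (A11 : 'M[R]_r) (A12 : 'M[R]_(r, q)) (A22 : 'M[R]_q)
    (B1 : 'M[R]_(r, m)) : Prop :=
  [/\ T \in unitmx,
      invmx T *m A *m T = castmx (e, e) (block_mx A11 A12 0 A22),
      invmx T *m B = castmx (e, erefl m) (col_mx B1 0)
    & controllable A11 B1].

(* The spectrum of A22 does not depend on the decomposition chosen. *)
Definition controllable_eigenvalue (R : realType) (n m : nat) (A : 'M[R]_n)
    (B : 'M[R]_(n, m)) (a : R) : Prop :=
  eigenvalue A a /\
  (controllable A B \/
   exists (r q : nat) (e : (r + q)%N = n) (T : 'M[R]_n) (A11 : 'M[R]_r)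
     (A12 : 'M[R]_(r, q)) (A22 : 'M[R]_q) (B1 : 'M[R]_(r, m)),
     kalman_form e A B T A11 A12 A22 B1 /\ ~~ eigenvalue A22 a).

(* [e_(j_1), ..., e_(j_m)], columns of the identity matrix. *)
Definition input_mx (R : realType) (n m : nat) (j : 'I_m -> 'I_n) :
    'M[R]_(n, m) :=
  colsub j 1%:M.

Definition control_nodes (n m : nat) (j : 'I_m -> 'I_n) : {set 'I_n} :=
  [set j k | k : 'I_m].

(* Main.v *)
Require Import Defs.
From HB Require Import structures.
From mathcomp Require Import all_boot all_order all_algebra.
From mathcomp Require Import reals.
From mathcomp Require Import ring lra.
From Stdlib Require Import Relation_Operators.

Set Implicit Arguments.
Unset Strict Implicit.
Unset Printing Implicit Defensive.

Import Order.TTheory GRing.Theory Num.Theory.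
Local Open Scope ring_scope.

(** By the Popov-Belevitch-Hautus test, [a] is controllable as soon as the only
    row vector [w] with [w *m (A - a%:M) = 0] and [w *m B = 0] is zero.  Since
    the columns of [B] are unit vectors, [w *m B = 0] says that [w] vanishes on
    the control nodes, which are the initially black ones.

    The game is a deduction system for the signs of such a [w].  Let [M] be a
    matrix with the pattern on which the game is played, and suppose
    [w *m M = 0].  Column [v] of this equation is a vanishing sum with one term
    for each out-neighbor [u] of [v], and the sign of the entry [M u v] is the
    label of the edge from [v] to [u] (a loop without a definite sign only
    matters at a black node, where it contributes nothing).  Read black as: the coordinate is zero;
    read marks as the signs of the coordinates of [w], up to one global sign.
    Forcing and balance say that a vanishing sum with a single term, or with
    terms of one sign, has only zero terms; the signing move says that the only
    term of unknown sign must compensate the others.  Marked coordinates may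
    well vanish, so the signs must be understood in the weak sense, as in
    [sound]; every rule is still correct for weak signs ([sound_move]).  When
    the whole graph is black, [w] is zero ([forces_all_sound]).

    The matrix [A - a%:M] has the pattern of the negative looped graph if
    [a > 0] and of the positive looped graph if [a < 0]
    ([has_pattern_shift]), and it is [A] itself if [a = 0].

    Controllability of an eigenvalue being expressed by a Kalman decomposition,
    that decomposition has to be constructed ([kalman_form_exists]); an
    eigenvector of its uncontrollable block then extends by zeros to a left
    eigenvector of [A] killed by [B] ([PBH_controllable_eigenvalue]). *)

(** * Real matrices with a given sign pattern *)

Section Signs.
Variable R : realType.
Implicit Types (s l : pm).

Definition pm_val s : R := if s is Plus then 1 else -1.

Lemma pm_valM s l : pm_val (mul_pm s l) = pm_val s * pm_val l.
Proof. by case: s; case: l => /=; ring. Qed.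

Lemma pm_val_inv s : pm_val (inv_pm s) = - pm_val s.
Proof. by case: s => /=; ring. Qed.

Lemma pm_val_sqr s : pm_val s * pm_val s = 1.
Proof. by case: s => /=; ring. Qed.

Lemma pm_val_neq0 s : pm_val s != 0.
Proof. by case: s; rewrite /= ?oppr_eq0 oner_eq0. Qed.

Lemma sign_Sgn l (x : R) : sign x = Sgn l -> 0 < pm_val l * x.
Proof. by rewrite /sign; case: ltgtP => // x_sg [<-] /=; lra. Qed.

Lemma sign_pm_val s (x : R) : 0 < pm_val s * x -> sign x = Sgn s.
Proof. by rewrite /sign; case: s => /= hx; case: ltgtP => // *; exfalso; lra. Qed.

Lemma sign_Zero (x : R) : sign x = Zero -> x = 0.
Proof. by rewrite /sign; case: ltgtP. Qed.

Lemma sign_neq_Any (x : R) : sign x <> Any.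
Proof. by rewrite /sign; case: ifP => // _; case: ifP. Qed.

End Signs.
Arguments pm_val {R} s.

Section Pattern.
Variables (R : realType) (n : nat) (P : 'M[label]_n) (M : 'M[R]_n).
Hypothesis MP : has_pattern P M.

Lemma pattern_sign u v : P u v <> Any -> sign (M u v) = P u v.
Proof.
case: MP => off diag; case: (eqVneq u v) => [<-|uv] nA; first by rewrite diag.
by rewrite off.
Qed.

Lemma pattern_Sgn u v l : P u v = Sgn l -> 0 < pm_val l * M u v.
Proof. by move=> Pl; apply: sign_Sgn; rewrite pattern_sign Pl. Qed.

Lemma pattern_Zero u v : P u v = Zero -> M u v = 0.
Proof. by move=> P0; apply: sign_Zero; rewrite pattern_sign P0. Qed.

Lemma pattern_Any u v : P u v = Any -> u = v.
Proof.
case: MP => off _ PA; apply/eqP/negPn/negP => /off; rewrite PA => sA.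
exact: (@sign_neq_Any _ (M u v)).
Qed.

End Pattern.

(** A diagonal entry of sign opposite to [s] may take any sign after the shift;
    the looped pattern then reads [Any], which imposes nothing. *)
Lemma has_pattern_shift (R : realType) n (P : 'M[label]_n) (A : 'M[R]_n)
    s (a : R) :
  has_pattern P A -> 0 < pm_val s * a -> has_pattern (looped s P) (A + a%:M).
Proof.
move=> AP a_s; split=> [i k ik|i].
  by rewrite !mxE (negPf ik) mulr0n addr0; case: AP => ->.
rewrite !mxE eqxx mulr1n.
case Pi: (P i i) => [r||] //=.
  case: eqP => // rs _; apply/esym/sign_pm_val.
  by have := pattern_Sgn AP Pi; rewrite rs mulrDr; lra.
by move=> _; apply/esym/sign_pm_val; rewrite (pattern_Zero AP Pi) add0r.
Qed.

(** * Soundness of the signing and coloring game *)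

Section Soundness.
Variables (R : realType) (n : nat) (P : 'M[label]_n) (M : 'M[R]_n).
Variable w : 'rV[R]_n.
Hypothesis MP : has_pattern P M.
Hypothesis wM : w *m M = 0.
Implicit Types (st : {ffun 'I_n -> status}) (u v : 'I_n) (s t l : pm).

(** The sign [t] is the global sign ambiguity: when no node is marked,
    any white node may be marked with [Plus], which is legitimate because [w]
    may be replaced by its opposite. *)
Definition sound t st : Prop :=
  (forall u, st u = Black -> w 0 u = 0) /\
  (forall u s, st u = White (Some s) -> 0 <= pm_val t * pm_val s * w 0 u).

(** This is what restricting the moves to active nodes is for: the only label
    without a definite sign is that of a loop, and a loop at a black node
    contributes nothing. *)
Lemma W_Sgn st v u :
  active P st v -> u \in W P st v -> exists l, P u v = Sgn l.
Proof.
move=> act; rewrite inE /edge; case Puv: (P u v) => [l||] //= wh.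
  by exists l.
have uv := pattern_Any MP Puv; rewrite uv in Puv wh.
by case: act => // stv; rewrite /white stv in wh.
Qed.

(** Terms outside [W P st v] vanish, either because the entry of [M] is zero or
    because the coordinate of [w] is. *)
Lemma column_sum_W t st v :
  sound t st -> \sum_(u in W P st v) w 0 u * M u v = 0.
Proof.
case=> blk _; have /matrixP/(_ 0 v) := wM; rewrite !mxE => col0.
rewrite -[RHS]col0 [RHS](bigID (mem (W P st v))) /= [X in _ = _ + X]big1 ?addr0 // => u.
rewrite inE /edge /white; case Puv: (P u v) => [l||] /=.
- by case Su: (st u) => //= _; rewrite blk ?mul0r.
- by rewrite (pattern_Zero MP Puv) mulr0.
- by case Su: (st u) => //= _; rewrite blk ?mul0r.
Qed.

Lemma W_sgn_term t st s v u :
  sound t st -> u \in W_sgn P st s v ->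
  0 <= pm_val t * pm_val s * (w 0 u * M u v).
Proof.
case=> _ mk; rewrite inE => /andP[_].
case Su: (st u) => [|[m|]] //; case Pl: (P u v) => [l||] // /eqP ml.
have w_ge := mk _ _ Su; have M_gt := pattern_Sgn MP Pl.
have := mulr_ge0 w_ge (ltW M_gt); rewrite ml pm_valM.
suff -> : pm_val t * (pm_val s * pm_val l) * w 0 u * (pm_val l * M u v) =
  pm_val t * pm_val s * (w 0 u * M u v) * (pm_val l * pm_val l) by
  rewrite pm_val_sqr mulr1.
by ring.
Qed.

Lemma term_eq0 st v u :
  active P st v -> u \in W P st v -> w 0 u * M u v = 0 -> w 0 u = 0.
Proof.
move=> act uW /eqP; rewrite mulf_eq0 => /orP[/eqP //|/eqP M0].
have [l Pl] := W_Sgn act uW.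
by have := pattern_Sgn MP Pl; rewrite M0 mulr0 ltxx.
Qed.

Lemma sound_blacken t st (S : {set 'I_n}) :
  sound t st -> {in S, forall u, w 0 u = 0} -> sound t (blacken st S).
Proof.
case=> blk mk S0; split=> [u|u s]; rewrite ffunE; case: ifP => //.
- by move=> /S0.
- by move=> _; apply: blk.
- by move=> _; apply: mk.
Qed.

Lemma sound_set_mark t st u s :
  sound t st -> 0 <= pm_val t * pm_val s * w 0 u ->
  sound t (set_mark st u s).
Proof.
case=> blk mk us; split=> [x|x r]; rewrite ffunE; case: eqP => //.
- by move=> _; apply: blk.
- by move=> -> [<-].
- by move=> _; apply: mk.
Qed.

(** The global sign is the same before and after every move except the one that
    starts a marking; there no mark constrains it, and it is chosen to agree
    with the sign of the coordinate being marked. *)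
Lemma sound_move st st' :
  (exists t, sound t st) -> move P st st' -> exists t, sound t st'.
Proof.
move=> [t snd] mv.
case: mv => [v u act Wu|v s act WsW|v x s l act Ws0 WsI Wx Pl|u nomk wh].
- exists t; apply: sound_blacken => // y; rewrite inE => /eqP ->.
  apply: (term_eq0 act); first by rewrite Wu inE.
  by have := column_sum_W v snd; rewrite Wu big_set1.
- exists t; apply: sound_blacken => // u uW.
  apply: (term_eq0 act uW).
  have ge0 y : y \in W P st v -> 0 <= pm_val t * pm_val s * (w 0 y * M y v).
    by rewrite -WsW; apply: W_sgn_term.
  have sum0 : \sum_(y in W P st v) pm_val t * pm_val s * (w 0 y * M y v) = 0.
    by rewrite -mulr_sumr (column_sum_W v snd) mulr0.
  have /eqP := psumr_eq0P ge0 sum0 uW.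
  by rewrite mulf_eq0 mulf_eq0 !(negPf (pm_val_neq0 _ _)) => /eqP.
- exists t; apply: sound_set_mark => //.
  have xWu : x \in W_unm P st v by rewrite Wx inE.
  have xW : x \in W P st v by move: xWu; rewrite inE => /andP[].
  have rest y : y \in W P st v -> y != x ->
      0 <= pm_val t * pm_val s * (w 0 y * M y v).
    move=> yW yx; apply: (W_sgn_term snd).
    (* A marked neighbor along a signed edge is in one of the two balanced
       sets, and the other one is empty. *)
    have yI : y \in W_sgn P st (inv_pm s) v = false by rewrite WsI inE.
    have yU : y \in W_unm P st v = false by rewrite Wx inE (negPf yx).
    have [k Pk] := W_Sgn act yW.
    move: yW yI yU; rewrite !inE => -> /=; rewrite Pk /marked.
    by case: (st y) => [|[r|]] //; case: r; case: (s); case: (k).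
  have := column_sum_W v snd; rewrite (bigD1 x xW) /= => sum0.
  have sum_ge : 0 <= \sum_(y in W P st v | y != x)
      pm_val t * pm_val s * (w 0 y * M y v).
    by apply: sumr_ge0 => y /andP[]; apply: rest.
  have x_le : pm_val t * pm_val s * (w 0 x * M x v) <= 0.
    have := congr1 (fun z => pm_val t * pm_val s * z) sum0.
    by rewrite mulrDr mulr0 mulr_sumr; lra.
  have M_gt := pattern_Sgn MP Pl.
  rewrite pm_valM pm_val_inv -(pmulr_lge0 _ M_gt).
  suff -> : pm_val t * (pm_val l * - pm_val s) * w 0 x * (pm_val l * M x v) =
    - (pm_val t * pm_val s * (w 0 x * M x v)) * (pm_val l * pm_val l) by
    rewrite pm_val_sqr mulr1 oppr_ge0.
  by ring.
- exists (if 0 <= w 0 u then Plus else Minus).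
  apply: sound_set_mark; last first.
    by case: ifP => /=; case: (ltP (w 0 u) 0) => //; lra.
  case: snd => blk _; split=> // y r stu.
  by have := nomk y; rewrite /marked stu.
Qed.

Lemma forces_all_sound (Z : {set 'I_n}) :
  {in Z, forall u, w 0 u = 0} -> forces_all P Z -> w = 0.
Proof.
move=> wZ [st [game allB]].
suff [t [blk _]] : exists t, sound t st.
  by apply/rowP => u; rewrite mxE; apply: blk.
have : exists t, sound t (init Z).
  exists Plus; split=> [u|u s]; rewrite ffunE; case: ifP => // uZ _.
  exact: wZ.
elim: game {allB} => [x y mv|//|x y z _ IHxy _ IHyz] snd.
  exact: sound_move snd mv.
exact/IHyz/IHxy.
Qed.

End Soundness.

(** * From the eigenvector test to the Kalman decomposition *)

Section Kalman.
Variables (R : realType) (m : nat).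

Definition kalman_mx n (A : 'M[R]_n) (B : 'M[R]_(n, m)) :=
  \mxrow_(k < n) (A ^+ k *m B).

(** By Cayley-Hamilton every power of [A] is a combination of the first [n]
    ones.  Stating this for left annihilators turns invariance of the
    controllable subspace, and rank conditions on Kalman matrices of different
    sizes, into shifts of the exponent [k]. *)
Lemma kalman_mx_eq0 n p (A : 'M[R]_n) (B : 'M_(n, m)) (X : 'M_(p, n)) :
  X *m kalman_mx A B = 0 <-> forall k : nat, X *m (A ^+ k *m B) = 0.
Proof.
rewrite /kalman_mx mul_mxrow -[X in _ = X](mxrow0 (q_ := fun=> m)); split.
  move=> /eq_mxrowP X0 k.
  case: n A B X X0 => [|n] A B X X0.
    by rewrite (thinmx0 X) mul0mx.
  have chi0 : char_poly A != 0 by rewrite -size_poly_gt0 size_char_poly.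
  have -> : A ^+ k = horner_mx A ('X^k %% char_poly A).
    have := congr1 (horner_mx A) (divp_eq 'X^k (char_poly A)).
    rewrite rmorphXn /= horner_mx_X rmorphD rmorphM /= Cayley_Hamilton.
    by rewrite mulr0 add0r.
  rewrite -[X in horner_mx A X]coefK poly_def rmorph_sum /= mulmx_suml.
  rewrite mulmx_sumr big1 // => i _.
  rewrite horner_mxZ rmorphXn /= horner_mx_X -scalemxAl -scalemxAr.
  have lt_i : (i < n.+1)%N.
    have := ltn_modpN0 'X^k chi0; rewrite size_char_poly ltnS.
    exact: leq_trans.
  by rewrite (X0 (Ordinal lt_i)) scaler0.
by move=> X0; apply/eq_mxrowP => k; apply: X0.
Qed.

(** The change of basis [T] starts with a basis of the column space of the
    Kalman matrix.  That space contains the columns of [B] and is stable under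
    [A], whence the two zero blocks.  The pair [(A11, B1)] is controllable
    because the Kalman matrix, written in the new basis, has top block [C1] of
    full row rank, and annihilating the first [r] terms of the sequence of the
    [A11 ^+ k *m B1] annihilates all of them, hence [C1]. *)
Lemma kalman_split r q (A : 'M[R]_(r + q)) (B : 'M[R]_(r + q, m)) :
  \rank (kalman_mx A B) = r ->
  exists T A11 A12 A22 B1,
    @kalman_form R (r + q) m r q erefl A B T A11 A12 A22 B1.
Proof.
move=> rk; set C := kalman_mx A B in rk.
pose T := col_ebase C; pose C1 := (pid_mx r : 'M_(r, _)) *m row_ebase C.
have uT : T \in unitmx := col_ebase_unit C.
have CE : invmx T *m C = col_mx C1 0.
  rewrite -[C in LHS]mulmx_ebase rk -!mulmxA mulKmx //.
  suff -> : pid_mx r = col_mx (pid_mx r) 0 :> 'M[R]_(r + q, \sum_(k < r + q) m).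
    by rewrite mul_col_mx mul0mx.
  apply/matrixP => i k; rewrite !mxE; case: split_ordP => i' ->.
    by rewrite mxE ltn_ord.
  by rewrite mxE /= andbF.
have C1_free : row_free C1.
  have := eqmxMfull C (_ : row_full (invmx T)).
  rewrite row_full_unit unitmx_inv => /(_ uT) [CC _].
  by rewrite /row_free -[X in _ == X]rk -CC CE rank_col_mx0.
pose N := invmx T *m A *m T.
pose lo : 'M[R]_(q, r + q) := row_mx 0 1%:M.
have NT k : N *m (invmx T *m (A ^+ k *m B)) = invmx T *m (A ^+ k.+1 *m B).
  by rewrite /N exprS -mulmxE -!mulmxA mulKVmx.
have lo0 k : lo *m (invmx T *m (A ^+ k *m B)) = 0.
  rewrite mulmxA; apply: (kalman_mx_eq0 _ _ _).1.
  by rewrite -mulmxA CE mul_row_col mul0mx mulmx0 addr0.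
have N21 : dlsubmx N = 0.
  have : lo *m N *m (invmx T *m C) = 0.
    rewrite mulmxA; apply/kalman_mx_eq0 => k.
    by rewrite -[_ *m _ *m _]mulmxA -[lo *m N *m _]mulmxA NT lo0.
  rewrite CE -[N]submxK mul_row_block !mul0mx !mul1mx !add0r.
  rewrite mul_row_col mulmx0 addr0 block_mxKdl => /eqP.
  by rewrite mulmx_free_eq0 // => /eqP.
have Nblk : N = block_mx (ulsubmx N) (ursubmx N) 0 (drsubmx N).
  by rewrite -[LHS]submxK N21.
have Bblk : invmx T *m B = col_mx (usubmx (invmx T *m B)) 0.
  rewrite -[LHS]vsubmxK; congr col_mx.
  have := lo0 0%N; rewrite expr0 mul1mx -[invmx T *m B]vsubmxK.
  by rewrite mul_row_col mul0mx mul1mx add0r col_mxKd.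
exists T, (ulsubmx N), (ursubmx N), (drsubmx N), (usubmx (invmx T *m B)).
rewrite /kalman_form !castmx_id; split=> //.
apply/eqP/inj_row_free => v /kalman_mx_eq0 v0.
have pow k : invmx T *m (A ^+ k *m B) =
    col_mx (ulsubmx N ^+ k *m usubmx (invmx T *m B)) 0.
  elim: k => [|k IHk]; first by rewrite !expr0 !mul1mx.
  rewrite -NT IHk {1}Nblk mul_block_col !mulmx0 mul0mx !addr0.
  by rewrite exprS -mulmxE mulmxA.
have : row_mx v 0 *m (invmx T *m C) = 0.
  rewrite mulmxA; apply/kalman_mx_eq0 => k.
  by rewrite -mulmxA pow mul_row_col v0 mul0mx addr0.
rewrite CE mul_row_col mul0mx addr0 => /eqP.
by rewrite mulmx_free_eq0 // => /eqP.
Qed.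

Lemma kalman_form_exists n (A : 'M[R]_n) (B : 'M[R]_(n, m)) :
  exists r q (e : (r + q)%N = n) T A11 A12 A22 B1,
    @kalman_form R n m r q e A B T A11 A12 A22 B1.
Proof.
have [r [q [e rk]]] : exists r q, exists _ : (r + q)%N = n,
    \rank (kalman_mx A B) = r.
  exists (\rank (kalman_mx A B)), (n - \rank (kalman_mx A B))%N.
  by exists (subnKC (rank_leq_row _)).
exists r, q, e; case: _ / e A B rk => A B; exact: kalman_split.
Qed.

(** If [v] is a left eigenvector of [A22], then [row_mx 0 v *m invmx T] is a left
    eigenvector of [A] for the same eigenvalue and is killed by [B]. *)
Lemma PBH_controllable_eigenvalue n (A : 'M[R]_n) (B : 'M[R]_(n, m)) a :
  eigenvalue A a ->
  (forall w : 'rV_n, w *m A = a *: w -> w *m B = 0 -> w = 0) ->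
  controllable_eigenvalue A B a.
Proof.
move=> Aa pbh; split=> //; right.
have [r [q [e [T [A11 [A12 [A22 [B1 kf]]]]]]]] := kalman_form_exists A B.
exists r, q, e, T, A11, A12, A22, B1; split=> //.
case: _ / e A B T {Aa} kf pbh => A B T.
rewrite /kalman_form !castmx_id => -[uT AT BT _] pbh.
apply/eigenvalueP => -[v vA] /eqP; apply.
pose u : 'rV_(r + q) := row_mx 0 v.
suff uT0 : u *m invmx T = 0.
  have : u = 0 by rewrite -[u](mulmxKV uT) uT0 mul0mx.
  by rewrite /u -row_mx0 => /eq_row_mx[].
apply: pbh.
  have -> : u *m invmx T *m A = u *m (invmx T *m A *m T) *m invmx T.
    by rewrite -!mulmxA mulmxV // mulmx1.
  rewrite AT mul_row_block !mul0mx mulmx0 !add0r vA scalemxAl scale_row_mx.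
  by rewrite scaler0.
by rewrite -mulmxA BT mul_row_col mul0mx mulmx0 addr0.
Qed.

End Kalman.

(** * Controllability of eigenvalues *)

Lemma mul_input_mx_eq0 (R : realType) (n m : nat) (j : 'I_m -> 'I_n)
    (w : 'rV[R]_n) :
  w *m input_mx R j = 0 -> {in control_nodes j, forall u, w 0 u = 0}.
Proof.
move=> wB u /imsetP[k _ ->].
by have /rowP/(_ k) := wB; rewrite mulmx_colsub mulmx1 !mxE.
Qed.

Lemma forces_all_controllable (R : realType) (n m : nat) (P : 'M[label]_n)
    (j : 'I_m -> 'I_n) (A : 'M[R]_n) (a : R) :
  has_pattern P (A - a%:M) -> forces_all P (control_nodes j) ->
  eigenvalue A a -> controllable_eigenvalue A (input_mx R j) a.
Proof.
move=> AP frc Aa; apply: PBH_controllable_eigenvalue => // w wA wB.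
apply: (forces_all_sound AP _ (mul_input_mx_eq0 wB) frc).
by rewrite mulmxBr wA mul_mx_scalar subrr.
Qed.

Theorem theorem2 (R : realType) (n m : nat) (G : signed_graph n)
    (j : 'I_m -> 'I_n) :
  (positive_signed_zfs G (control_nodes j) ->
   forall (A : 'M[R]_n), qual_class G A ->
   forall a : R, 0 < a -> eigenvalue A a ->
   controllable_eigenvalue A (input_mx R j) a) /\
  (negative_signed_zfs G (control_nodes j) ->
   forall (A : 'M[R]_n), qual_class G A ->
   forall a : R, a < 0 -> eigenvalue A a ->
   controllable_eigenvalue A (input_mx R j) a) /\
  (signed_zfs G (control_nodes j) ->
   forall (A : 'M[R]_n), qual_class G A -> eigenvalue A 0 ->
   controllable_eigenvalue A (input_mx R j) 0).
Proof.
split; [|split].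
- move=> frc A [AP _] a a_gt; apply: forces_all_controllable frc.
  by rewrite -raddfN; apply: has_pattern_shift => //=; lra.
- move=> frc A [AP _] a a_lt; apply: forces_all_controllable frc.
  by rewrite -raddfN; apply: has_pattern_shift => //=; lra.
- move=> frc A [AP _]; apply: forces_all_controllable frc.
  by rewrite raddf0 subr0.
Qed.
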